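(* For every $\varepsilon>0$ there exists $d_0$ such that every finite simple graph $G$ with minimum degree $d\geq d_0$ satisfies $\vec{\chi}_{\ell}(G)\geq \left(\tfrac{1}{3}-\varepsilon\right)\log_2 d$. (That is, every graph $G$ with minimum degree $d$ satisfies $\vec{\chi}_{\ell}(G)\geq(\tfrac13-o(1))\log_2 d$, where $o(1)\to 0$ as $d\to\infty$.)
   Context: A digraph $D$ is an orientation of a graph $G$ if its underlying graph is $G$ and it has at most one arc between each pair of vertices. A $k$-list assignment $L$ of a digraph $D$ assigns to each vertex $v$ a finite set $L(v)$ of at least $k$ positive integers. An $L$-dicolouring of $D$ is a function $\varphi:V(D)\to\mathbb{Z}^+$ with $\varphi(v)\in L(v)$ for all $v$ such that for each $i$ the subdigraph induced by $\varphi^{-1}(i)$ has no directed cycle. The dichoosability $\vec{\chi}_{\ell}(D)$ is the least $k$ such that for every $k$-list assignment $L$ of $D$, $D$ admits an $L$-dicolouring. For a graph $G$, $\vec{\chi}_{\ell}(G)$ is the maximum of $\vec{\chi}_{\ell}(D)$ over all orientations $D$ of $G$. *)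

(* Defs.v *)
From mathcomp Require Import all_boot all_order all_algebra.
From mathcomp Require Import finmap.
From mathcomp Require Import all_classical all_reals all_analysis.

Set Implicit Arguments.
Unset Strict Implicit.
Unset Printing Implicit Defensive.

Import Order.TTheory GRing.Theory Num.Theory.

Local Open Scope fset_scope.

Section Graph.
Variable T : finType.

Definition simple_graph (e : rel T) : Prop := symmetric e /\ irreflexive e.

Definition degree (e : rel T) (v : T) : nat := #|[pred w | e v w]|.

(* The neutral value #|T| bounds every degree, so it never affects the minimum
   of a nonempty graph; the empty graph gets minimum degree 0. *)
Definition min_degree (e : rel T) : nat := \big[minn/#|T|]_(v : T) degree e v.

(* A digraph on T is its set of arcs; (u, v) is the arc from u to v. *)
Definition arc (D : {set T * T}) : rel T := fun u v => (u, v) \in D.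

Definition orientation (e : rel T) (D : {set T * T}) : bool :=
  [forall u, forall v,
     (e u v == arc D u v || arc D v u) && ~~ (arc D u v && arc D v u)].

(* The list c of distinct vertices is read cyclically. Orientations of simple
   graphs have no loops or digons, so there c has at least three vertices. *)
Definition directed_cycle (D : {set T * T}) (c : seq T) : Prop :=
  c <> [::] /\ ucycle (arc D) c.

Definition induces_acyclic (D : {set T * T}) (A : pred T) : Prop :=
  forall c : seq T, directed_cycle D c -> ~ {subset c <= A}.

Definition list_assignment (k : nat) (L : T -> {fset nat}) : Prop :=
  forall v, (k <= #|` L v|)%N /\ (forall i, i \in L v -> (0 < i)%N).

Definition dicolouring (D : {set T * T}) (L : T -> {fset nat})
    (phi : T -> nat) : Prop :=
  (forall v, phi v \in L v) /\
  (forall i, induces_acyclic D [pred v | phi v == i]).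

Definition dichoosable (D : {set T * T}) (k : nat) : Prop :=
  forall L, list_assignment k L -> exists phi, dicolouring D L phi.

(* The least k such that D is dichoosable from k-lists. The value 0 in the
   other branch is only for digraphs with loops, see dichoosabilityP. *)
Definition dichoosability (D : {set T * T}) : nat :=
  match pselect (exists k, `[< dichoosable D k >]) with
  | left h => ex_minn h
  | right _ => 0%N
  end.

Definition graph_dichoosability (e : rel T) : nat :=
  (\max_(D : {set T * T} | orientation e D) dichoosability D)%N.

Lemma min_degreeP (e : rel T) : irreflexive e -> (0 < #|T|)%N ->
  (exists v, degree e v = min_degree e) /\
  (forall v, (min_degree e <= degree e v)%N).
Proof.
move=> irr /card_gt0P[x _].
have lb v : (min_degree e <= degree e v)%N.
  rewrite /min_degree; have := mem_index_enum v.
  elim: (index_enum T) => [//|w s IH]; rewrite inE big_cons => /orP[/eqP <-|/IH].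
    exact: geq_minl.
  exact: leq_trans (geq_minr _ _).
split=> //; case: (arg_minnP (degree e) (isT : xpredT x)) => v _ vmin.
exists v; apply/eqP; rewrite eqn_leq lb andbT /min_degree.
apply: (big_ind (fun m => (degree e v <= m)%N)).
- exact: max_card.
- by move=> a b ? ?; rewrite leq_min; apply/andP.
- by move=> w _; apply: vmin.
Qed.

Lemma orientation_loopless (e : rel T) (D : {set T * T}) :
  orientation e D -> irreflexive (arc D).
Proof.
move=> /forallP oD v; have /forallP/(_ v)/andP[_] := oD v.
by rewrite andbb => /negbTE.
Qed.

Lemma dichoosable_leq (D : {set T * T}) (k l : nat) :
  (k <= l)%N -> dichoosable D k -> dichoosable D l.
Proof.
move=> kl chk L HL; apply: chk => v; have [h1 h2] := HL v.
by split=> //; apply: leq_trans h1.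
Qed.

Lemma dichoosable_card (D : {set T * T}) :
  irreflexive (arc D) -> dichoosable D #|T|.
Proof.
move=> irr L HL.
have sel (s : seq T) : uniq s ->
    exists phi : T -> nat, {in s, forall v, phi v \in L v} /\ {in s &, injective phi}.
  elim: s => [|x s IH] /=; first by exists (fun=> 0%N).
  move=> /andP[xs us]; have [phi [phiL phiI]] := IH us.
  have [i iL iN] : exists2 i, i \in L x & i \notin map phi s.
    apply: contrapT => H.
    have sub : {subset L x <= map phi s}.
      by move=> i iL; apply: contrapT => /negP iN; apply: H; exists i.
    have := uniq_leq_size (fset_uniq (L x)) sub.
    rewrite size_map leqNgt => /negP; apply.
    apply: leq_trans (HL x).1; rewrite ltnNge; apply/negP => le.
    have uxs : uniq (x :: s) by rewrite /= xs.
    have := uniq_leq_size uxs (fun y _ => mem_enum T y).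
    by rewrite -cardE /= ltnNge le.
  exists (fun v => if v == x then i else phi v); split=> [v|v w].
    by rewrite inE; case: eqP => [->//|_ /=]; apply: phiL.
  rewrite !inE; case: eqP => [->|_] /=; case: eqP => [->|_] //=.
  - by move=> _ ws E; case/negP: iN; rewrite E map_f.
  - by move=> vs _ E; case/negP: iN; rewrite -E map_f.
  - exact: phiI.
have [phi [phiL phiI]] := sel _ (enum_uniq T).
exists phi; split=> [v|i [|x [|y c]] [//= _]].
- by apply: phiL; rewrite mem_enum.
- by rewrite /ucycle /= irr.
- move=> /andP[_ /= /andP[]]; rewrite inE negb_or => /andP[/eqP xy _] _ sub.
  apply: xy; apply: phiI; rewrite ?mem_enum //.
  have /eqP -> : phi x == i by apply: (sub x); rewrite !inE eqxx.
  by apply/esym/eqP; apply: (sub y); rewrite !inE eqxx orbT.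
Qed.

Lemma dichoosabilityP (D : {set T * T}) (k : nat) : irreflexive (arc D) ->
  dichoosable D k <-> (dichoosability D <= k)%N.
Proof.
move=> irr; rewrite /dichoosability; case: pselect => [h|[]]; last first.
  by exists #|T|; apply/asboolP/dichoosable_card.
case: ex_minnP => m /asboolP mP mmin; split=> [kP|mk].
  by apply: mmin; apply/asboolP.
exact: dichoosable_leq mP.
Qed.

End Graph.

Definition log2 (R : realType) (x : R) : R := (ln x / ln 2)%R.

(* Main.v *)
Require Import Defs.
From mathcomp Require Import all_boot all_order all_algebra.
From mathcomp Require Import finmap.
From mathcomp Require Import zify lra.

(** Let k be about (1/3) log2 d and draw lists of size k from 2h = O(k^2)
    colours. Put each vertex in B with probability 1/P, where P = k 2^(k+6),
    and draw lists on B. Since d >> P 2^k h t, most vertices v are such that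
    every half X of the palette contains the lists of h t neighbours of v in B;
    then for every colouring of B at least half of the colours occur t times
    among those neighbours. A random list at such a vertex lies inside that
    half with probability about 2^-k, and B is so small that a union bound over
    its colourings applies: some lists force t n 2^-k monochromatic edges, up
    to constants, in every colouring. With t about k 2^k this is a large
    multiple of k n, and P 2^k t is about 2^(3k).

    A graph with degrees d_v has at most prod (d_v + 1) acyclic orientations,
    because such an orientation is determined by one in-neighbour of v of
    maximal height for each v. So a colouring with m monochromatic edges is a
    dicolouring for a proportion at most 2^(O(n) - m/2) of the orientations,
    and a union bound over the (2h)^n colourings leaves an orientation without
    L-dicolouring. *)

Set Implicit Arguments.
Unset Strict Implicit.

(** * Counting inequalities *)

Lemma binomial_two_terms x n : x ^ n.+1 + n.+1 * x ^ n <= x.+1 ^ n.+1.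
Proof.
elim: n => [|n IH]; first by rewrite !expn1 expn0; lia.
rewrite (expnS x.+1); apply: leq_trans (leq_mul (leqnn x.+1) IH).
rewrite (expnS x n.+1) (expnS x n); nia.
Qed.

(** The first two binomial terms give (q+1)^(q+1) >= 2 q^(q+1), so each of m blocks of q + 1 factors
    gains a factor 2. *)
Lemma double_pred_exp q m a : q.+1 * m <= a -> 2 ^ m * q ^ a <= q.+1 ^ a.
Proof.
move=> /subnKC <-; rewrite (expnD q) (expnD q.+1) mulnA.
apply: leq_mul; last first.
  by case: (_ - _) => [|j]; [rewrite !expn0 | rewrite leq_exp2r].
rewrite (expnM q) (expnM q.+1) -expnMn.
case: m => [|m]; rewrite ?expn0 // leq_exp2r //.
by apply: leq_trans (binomial_two_terms q q); rewrite expnS; lia.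
Qed.

(* The Chernoff bound P(successes < x) <= 2^x E[2^-successes], with both sides
   multiplied out so that it becomes a count of functions. *)
Lemma count_few_successes (I O : finType) (A : {set I}) (S : I -> pred O)
    (N m x : nat) :
  0 < N -> {in A, forall i, #|O| <= N * #|S i|} -> 2 * N * m <= #|A| ->
  #|[set w : {ffun I -> O} | #|[set i in A | S i (w i)]| < x]| * 2 ^ m
    <= 2 ^ x * #|O| ^ #|I|.
Proof.
move=> N0 SN Am.
(* On A the weight is 2 * 2^-[success], which keeps it integral. *)
pose wt i y := if i \in A then (if S i y then 1 else 2) else 1.
set Bad := [set w | _].
have wtE (w : {ffun I -> O}) :
    2 ^ #|A| = 2 ^ #|[set i in A | S i (w i)]| * \prod_i wt i (w i).
  rewrite -2!prod_nat_const big_mkcond [X in X * _]big_mkcond -big_split /=.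
  apply: eq_bigr => i _; rewrite /wt inE.
  by case: (i \in A); case: (S i (w i)).
have badw : #|Bad| * 2 ^ #|A|
    <= 2 ^ x * \sum_(w : {ffun I -> O}) \prod_i wt i (w i).
  rewrite -sum_nat_const big_distrr /= [X in _ <= X](bigID (mem Bad)) /=.
  apply: leq_trans (leq_addr _ _); apply: leq_sum => w.
  by rewrite inE => wx; rewrite (wtE w) leq_mul2r leq_exp2l // (ltnW wx) orbT.
(* For i in A the weights of one coordinate sum to 2|O| - |S i| <= (2 - 1/N)|O|. *)
have fac : N ^ #|A| * \sum_(w : {ffun I -> O}) \prod_i wt i (w i)
    <= (2 * N).-1 ^ #|A| * #|O| ^ #|I|.
  rewrite -(bigA_distr_bigA wt) -!prod_nat_const.
  rewrite [X in X * _]big_mkcond [X in _ <= X * _]big_mkcond -!big_split /=.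
  apply: leq_prod => i _; rewrite /wt; case: ifP => iA; last first.
    by rewrite sum1_card.
  have E : \sum_(y : O) (if S i y then 1 else 2) + #|S i| = 2 * #|O|.
    rewrite -sum1_card mulnC -sum_nat_const [X in _ + X]big_mkcond -big_split.
    by apply: eq_bigr => y _; rewrite -topredE /=; case: (S i y).
  have := SN i iA; have := congr1 (muln N) E; rewrite mulnDr => E' NS.
  rewrite -(leq_add2r (N * #|S i|)) E'.
  rewrite (_ : N * (2 * #|O|) = (2 * N).-1 * #|O| + #|O|).
    by rewrite leq_add2l.
  by rewrite -mulSnr prednK ?muln_gt0 //; lia.
have lt := @double_pred_exp (2 * N).-1 m #|A|.
have P0 : 0 < (2 * N) ^ #|A| by rewrite expn_gt0 muln_gt0 N0.
rewrite -(leq_pmul2l P0).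
move: lt; rewrite prednK ?muln_gt0 ?N0 // => /(_ Am) lt.
apply: (@leq_trans (2 ^ x * #|O| ^ #|I| * (2 ^ m * (2 * N).-1 ^ #|A|)));
  last first.
  by rewrite [X in _ <= X]mulnC leq_mul2l lt orbT.
rewrite (_ : _ * (_ * _) = (#|Bad| * 2 ^ #|A|) * (N ^ #|A| * 2 ^ m));
  last first.
  by rewrite expnMn; lia.
apply: leq_trans (leq_mul badw (leqnn _)) _.
set s := \sum_(_ | _) _ in fac *.
rewrite (_ : _ * _ * _ = 2 ^ x * 2 ^ m * (N ^ #|A| * s)); last by lia.
apply: leq_trans (leq_mul (leqnn _) fac) _.
by lia.
Qed.

(** Bernoulli's inequality (1 - 1/(x+1))^j >= 1 - j/(x+1), multiplied out. *)
Lemma bernoulli_sub x j : j <= x.+1 -> x.+1 ^ j * (x.+1 - j) <= x ^ j * x.+1.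
Proof.
elim: j => [|j IH] jx; first by rewrite !expn0 subn0.
rewrite !expnS -[x * _ * _]mulnA.
apply: leq_trans (leq_mul (leqnn x) (IH (ltnW jx))).
rewrite [X in _ <= X]mulnCA -mulnA [X in X <= _]mulnCA leq_mul2l.
by apply/orP; right; nia.
Qed.

(** Factor by factor: (2h - i)/(h - i) <= 2 + 1/k for i < k, because (k + 1) i <= h. *)
Lemma ffact_double_leq k h j : k * k + k <= h -> j <= k ->
  k ^ j * (2 * h) ^_ j <= (2 * k).+1 ^ j * h ^_ j.
Proof.
move=> kh; elim: j => // j IH jk; rewrite !ffactnSr !expnS.
have := IH (ltnW jk).
set a := k ^ j; set b := _ ^_ j; set c := _ ^ j; set d := _ ^_ j.
move=> abcd.
have : k * (2 * h - j) <= (2 * k).+1 * (h - j) by nia.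
by move=> H; have := leq_mul abcd H; lia.
Qed.

(** The quotient is at most (2 + 1/k)^k = 2^k (1 + 1/(2k))^k, and Bernoulli bounds the last power by
    (2k + 1)/(k + 1) <= 2. *)
Lemma bin_double_leq k h : k * k + k <= h ->
  'C(2 * h, k) <= 2 ^ k.+1 * 'C(h, k).
Proof.
case: k => [|k] kh; first by rewrite !bin0.
set K := k.+1 in kh *.
have K0 : 0 < K ^ K by rewrite expn_gt0.
have /= B := @bernoulli_sub (2 * K) K; rewrite expnMn in B.
have B' : (2 * K).+1 ^ K <= 2 ^ K.+1 * K ^ K.
  rewrite -(@leq_pmul2r K.+1) // expnS; move: (B ltac:(lia)).
  by rewrite (_ : _ - K = K.+1); nia.
have := @ffact_double_leq K h K kh (leqnn _).
rewrite -!bin_ffact; have := fact_gt0 K; move: K`! => f f0.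
rewrite !mulnA leq_pmul2r // => H.
rewrite -(leq_pmul2l K0); apply: leq_trans H _.
by rewrite mulnA [K ^ K * _]mulnC; apply: leq_mul.
Qed.

Lemma card_bigcup_le (I O : finType) (P : pred I) (B : I -> {set O})
    (K M : nat) :
  (forall i, P i -> #|B i| * K <= M) ->
  #|\bigcup_(i | P i) B i| * K <= #|P| * M.
Proof.
move=> BM; apply: (@leq_trans (\sum_(i | P i) #|B i| * K)).
  rewrite -big_distrl leq_mul2r /=; apply/orP; right.
  elim/big_rec2: _ => [|i a b _]; first by rewrite cards0.
  by move=> ab; apply: leq_trans (leq_card_setU _ _) _; rewrite leq_add2l.
rewrite -sum_nat_const; exact: leq_sum.
Qed.

Lemma union_bound (I O : finType) (P : pred I) (B : I -> {set O}) (K : nat) :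
  0 < #|O| -> #|P| < K -> (forall i, P i -> #|B i| * K <= #|O|) ->
  exists w, forall i, P i -> w \notin B i.
Proof.
move=> O0 PK BO; have := card_bigcup_le BO.
set U := \bigcup_(i | P i) B i => UK.
have [w wU] : exists w, w \in ~: U.
  by apply/card_gt0P; have := cardsC U; nia.
exists w => i Pi; apply: contraTN wU => wi.
by rewrite inE negbK; apply/bigcupP; exists i.
Qed.

Lemma averaging (I O : finType) (U : I -> {set O}) (K : nat) :
  0 < #|O| -> (forall i, #|U i| * K <= #|O|) ->
  exists w, K * #|[set i | w \in U i]| <= #|I|.
Proof.
move=> O0 UK.
have [w Kw|no] := pickP (fun w => K * #|[set i | w \in U i]| <= #|I|).
  by exists w.
suff : #|O| * #|I|.+1 <= #|O| * #|I| by rewrite leq_pmul2l // ltnn.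
rewrite -sum_nat_const.
apply: (@leq_trans (\sum_(w : O) K * #|[set i | w \in U i]|)).
  by apply: leq_sum => w _; rewrite ltnNge no.
have -> : \sum_(w : O) K * #|[set i | w \in U i]| = \sum_i #|U i| * K.
  rewrite -big_distrr -big_distrl /= mulnC; congr (_ * _).
  under eq_bigr => w _ do rewrite -sum1dep_card big_mkcond.
  rewrite exchange_big; apply: eq_bigr => i _.
  by rewrite -big_mkcond sum1_card.
by rewrite mulnC -sum_nat_const; apply: leq_sum.
Qed.

(** * Acyclic orientations *)

Section ParentMap.
Variable T : finType.
Implicit Types (r : rel T) (u v : T).

Definition acyclic r := [forall u, forall v, r u v ==> ~~ connect r v u].

Lemma acyclicP r : reflect (forall u v, r u v -> ~~ connect r v u) (acyclic r).
Proof. by apply: (iffP 'forall_'forall_implyP) => H u v; apply: H. Qed.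

Fixpoint walk_to r (i : nat) v : bool :=
  if i is j.+1 then [exists u, r u v && walk_to r j u] else true.

(** Along an arc from u to v the set of vertices reaching the endpoint strictly grows, as v does not
    reach u. Hence the range of [height] misses no walk length. *)
Lemma walk_to_bound r i v : acyclic r -> walk_to r i v -> i < #|T|.+1.
Proof.
move=> /acyclicP acr wi; suff: i < #|[pred x | connect r x v]|.
  by move/leq_trans; apply; apply: ltnW; apply: max_card.
elim: i v wi => [|i IH] v /=.
  by move=> _; apply/card_gt0P; exists v; rewrite inE connect0.
case/existsP=> u /andP[uv /IH iu]; apply: leq_ltn_trans iu _.
apply/proper_card/properP; split.
  apply/subsetP=> x; rewrite !inE => xu.
  exact: connect_trans xu (connect1 uv).
by exists v; rewrite !inE ?connect0 ?acr.
Qed.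

Definition height r v := \max_(i < #|T|.+1 | walk_to r i v) i.

Lemma height_max r i v : acyclic r -> walk_to r i v -> i <= height r v.
Proof.
by move=> acr wi; apply: (leq_bigmax_cond (Ordinal (walk_to_bound acr wi))).
Qed.

Lemma walk_to_height r v : walk_to r (height r v) v.
Proof.
rewrite /height.
have [|i wi ->] := @eq_bigmax_cond _ (fun i : 'I_#|T|.+1 => walk_to r i v)
  (fun i => i : nat).
  by apply/card_gt0P; exists ord0.
exact: wi.
Qed.

Lemma height_lt r u v : acyclic r -> r u v -> height r u < height r v.
Proof.
move=> acr uv; apply: height_max => //=.
by apply/existsP; exists u; rewrite uv walk_to_height.
Qed.

(** For acyclic [r] the equation selects an in-neighbour of maximal height; sources get [None]. *)
Definition parent r : {ffun T -> option T} :=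
  [ffun v => [pick u | r u v && (height r v == (height r u).+1)]].

Lemma parentP r u v : parent r v = Some u -> r u v.
Proof. by rewrite ffunE; case: pickP => // w /andP[rw _] [<-]. Qed.

Lemma height_parent r v : acyclic r ->
  height r v = oapp (fun u => (height r u).+1) 0 (parent r v).
Proof.
move=> acr; rewrite ffunE; case: pickP => [u /andP[_ /eqP //]|no] /=.
case E: (height r v) (walk_to_height r v) => [//|i] /= /existsP[u /andP[uv wu]].
have := no u; rewrite uv eqn_leq height_lt // andbT E ltnS /=.
by rewrite height_max.
Qed.

(* The height of v is its depth in the forest of parents. *)
Lemma eq_height r r' : acyclic r -> acyclic r' -> parent r = parent r' ->
  height r =1 height r'.
Proof.
move=> acr acr' pp v; have [n] := ubnP (height r v); elim: n v => // n IH v.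
rewrite (height_parent v acr) (height_parent v acr') -pp.
by case: (parent r v) => //= u lu; rewrite IH.
Qed.

End ParentMap.

Section Orientations.
Variables (T : finType) (e : rel T).
Hypothesis simple : simple_graph e.
Implicit Types (u v : T) (F : {set T * T}).

Definition before u v := enum_rank u < enum_rank v.

(* Only the bits of F at pairs (u, v) with u before v matter. The others are
   idle, so that a uniform set F induces a uniform orientation. *)
Definition orient F : {set T * T} :=
  [set a | e a.1 a.2 &&
     (if before a.1 a.2 then a \in F else (a.2, a.1) \notin F)].

Lemma before_antisym u v : u != v -> before v u = ~~ before u v.
Proof.
move=> uv; rewrite /before -leqNgt ltn_neqAle eq_sym.
by rewrite (inj_eq (@ord_inj _)) (inj_eq (@enum_rank_inj _)) uv.
Qed.

Lemma orient_orientation F : orientation e (orient F).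
Proof.
have [sym irr] := simple.
apply/forallP=> u; apply/forallP=> v.
rewrite /Defs.arc /orient !inE /= (sym v u).
case euv: (e u v) => //=.
have uv : u != v by apply/eqP => E; rewrite E irr in euv.
by rewrite (before_antisym uv); case: (before u v) => /=; case: (_ \in F).
Qed.

Variables (C : eqType) (phi : T -> C).

Definition mono u v := e u v && (phi u == phi v).

Definition mono_arc F u v := Defs.arc (orient F) u v && (phi u == phi v).

Definition mono_pairs : {set T * T} := [set a | mono a.1 a.2 && before a.1 a.2].

Lemma mono_arcW F u v : mono_arc F u v -> mono u v.
Proof.
by rewrite /mono_arc /mono /Defs.arc /orient inE /= => /andP[/andP[-> _] ->].
Qed.

Lemma mono_sym u v : mono u v = mono v u.
Proof. by rewrite /mono (proj1 simple) eq_sym. Qed.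

Lemma mono_pairs_card : \sum_v #|[pred u | mono u v]| <= 2 * #|mono_pairs|.
Proof.
pose sw (a : T * T) := (a.2, a.1).
have swI : injective sw by move=> [a b] [c d] [-> ->].
rewrite mul2n -addnn -{2}(card_imset _ swI).
apply: leq_trans (leq_card_setU _ _).
rewrite [X in X <= _](_ : _ = #|[set a : T * T | mono a.1 a.2]|).
  apply/subset_leq_card/subsetP => -[u v]; rewrite /mono_pairs !inE /= => m.
  rewrite m /=; case b: (before u v) => //=.
  apply/imsetP; exists (v, u) => //; rewrite /mono_pairs inE /= mono_sym m /=.
  rewrite before_antisym ?b //.
  by apply: contraTneq m => ->; rewrite /mono (proj2 simple).
rewrite -sum1dep_card -(pair_big_dep xpredT mono (fun _ _ => 1)) /=.
apply: eq_bigr => v _; rewrite -sum1_card; apply: eq_bigl => u.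
by rewrite inE mono_sym.
Qed.

(** F is recovered from the parents in [mono_arc F] and its bits off [mono_pairs]: parents determine
    heights, and monochromatic arcs go up in height. Each parent is [None] or a monochromatic
    neighbour, whence the product. *)
Lemma count_acyclic :
  #|[set F | acyclic (mono_arc F)]|
    <= (\prod_v #|[pred u | mono u v]|.+1) * 2 ^ (#|T| ^ 2 - #|mono_pairs|).
Proof.
pose code F := (parent (mono_arc F), F :\: mono_pairs).
pose opts v := [pred o : option T | if o is Some u then mono u v else true].
have optsE v : #|opts v| = #|[pred u | mono u v]|.+1.
  have -> : #|opts v| = #|None |: Some @: [set u | mono u v]|.
    apply: eq_card => -[u|]; rewrite !inE //= mem_imset ?inE //.
    by move=> a b [].
  rewrite cardsU1 card_imset; last by move=> a b [].
  rewrite cardsE; case: imsetP => // -[u _ //].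
have inj : {in [set F | acyclic (mono_arc F)] &, injective code}.
  move=> F F'; rewrite !inE => acF acF' [pp EF].
  have hh := eq_height acF acF' pp.
  apply/setP=> -[u v].
  have [|uv] := boolP ((u, v) \in mono_pairs); last first.
    by have /setP/(_ (u, v)) := EF; rewrite !inE in uv *; rewrite uv.
  rewrite /mono_pairs inE /= => /andP[m b].
  have key G : acyclic (mono_arc G) ->
      ((u, v) \in G) = (height (mono_arc G) u < height (mono_arc G) v).
    move=> acG; have b' : before v u = false.
      by apply/negbTE; rewrite /before -leqNgt ltnW.
    apply/idP/idP => uvG.
      apply: height_lt => //; move: m.
      by rewrite /mono_arc /Defs.arc /orient inE /= b uvG andbT.
    apply: contraTT uvG => uvG; rewrite -leqNgt ltnW //.
    apply: height_lt => //; move: m.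
    by rewrite mono_sym /mono_arc /Defs.arc /orient inE /= b' uvG andbT.
  by rewrite (key F) // (key F') // !hh.
rewrite -(card_in_imset inj).
have -> : \prod_v #|[pred u | mono u v]|.+1 = #|[set p | p \in family opts]|.
  rewrite cardsE card_family foldrE big_image /=.
  by apply: eq_bigr => v _; rewrite optsE.
have -> : 2 ^ (#|T| ^ 2 - #|mono_pairs|) = #|powerset (~: mono_pairs)|.
  by rewrite card_powerset [#|~: _|]cardsCs setCK card_prod.
rewrite -cardsX; apply/subset_leq_card/subsetP=> _ /imsetP[F _ ->].
rewrite in_setX inE /= powersetE; apply/andP; split.
  apply/familyP=> v; rewrite inE; case E: (parent _ v) => [u|//].
  exact: mono_arcW (parentP E).
by apply/subsetP=> a; rewrite !inE => /andP[].
Qed.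

(** That is, x + 1 <= 2^(2 + x/4), free of fractions. For degrees x with sum S <= 2m, the parents
    then cost only 2^(2n + m/2) against the gain 2^m. *)
Lemma succ_exp4 x : x.+1 ^ 4 <= 2 ^ (8 + x).
Proof.
have : x.+1 <= 4 * 2 ^ (x %/ 4).
  have := ltn_expl (x %/ 4) (isT : 1 < 2); have := divn_eq x 4.
  by have := ltn_mod x 4; lia.
rewrite -(@leq_exp2r _ _ 4) // => /leq_trans; apply.
rewrite expnMn -expnM (_ : 4 ^ 4 = 2 ^ 8) // -expnD leq_exp2l // leq_add2l.
exact: leq_trunc_div.
Qed.

(** With S the degree sum and m >= S/2 the number of pairs, the exponent n^2 + 2n + S/4 - m is at
    most n^2 + 2n - S/4, and S/4 >= n(k + 3). *)
Lemma count_acyclic_pow2 k :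
  4 * #|T| * (k + 3) <= \sum_v #|[pred u | mono u v]| ->
  #|[set F | acyclic (mono_arc F)]| * 2 ^ (#|T| * k.+1) <= 2 ^ (#|T| ^ 2).
Proof.
move=> Hm; have M2 := mono_pairs_card.
rewrite -(@leq_exp2r _ _ 4) // expnMn.
have := count_acyclic; rewrite -(@leq_exp2r _ _ 4) // => ca.
apply: leq_trans (leq_mul ca (leqnn _)) _.
have mT : #|mono_pairs| <= #|T| ^ 2 by rewrite -[_ ^ 2]card_prod max_card.
have P4 : (\prod_v #|[pred u | mono u v]|.+1) ^ 4
    <= 2 ^ (8 * #|T| + \sum_v #|[pred u | mono u v]|).
  rewrite (big_morph (fun x => x ^ 4) (fun x y => expnMn x y 4) (exp1n 4)).
  rewrite mulnC -[#|T| * 8]sum_nat_const -big_split expn_sum /=.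
  by apply: leq_prod => v _; apply: succ_exp4.
rewrite expnMn; apply: leq_trans (leq_mul (leq_mul P4 (leqnn _)) (leqnn _)) _.
rewrite -!expnM -!expnD leq_exp2l //.
move: mT M2 Hm; move: (\sum_v _) #|mono_pairs| (#|T| ^ 2) #|T| => a b c d.
by lia.
Qed.
End Orientations.

(** * Union bound over the colourings *)

Section AvoidingColourings.
Variables (T : finType) (e : rel T).

Lemma dicoloured_acyclic (C : eqType) (phi : T -> C) F :
  (forall c, induces_acyclic (orient e F) [pred v | phi v == c]) ->
  acyclic (mono_arc e phi F).
Proof.
move=> acyc; apply/acyclicP => u v ruv; apply/negP => /connectP[p vp pu].
(* Shortening the return path makes the closed walk a cycle; its arcs are monochromatic, so it stays
   in one colour class. *)
have {vp pu}[q [vq uq qu]] : exists q,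
    [/\ path (mono_arc e phi F) v q, uniq (v :: q) & u = last v q].
  by move: vp pu; case/shortenP => q vq uq _ pu; exists q.
have col : {subset v :: q <= [pred x | phi x == phi v]}.
  move=> x; rewrite inE => /predU1P[->|]; first by rewrite inE.
  elim: q v vq {ruv uq qu} => //= y q IH v /andP[/andP[_ /eqP ->] yq].
  by rewrite inE => /predU1P[->|/IH]; [rewrite inE | apply].
apply: (acyc (phi v)) col; split=> //; rewrite /ucycle uq andbT /= rcons_path.
rewrite -qu; case/andP: (ruv) => -> _; rewrite andbT.
by apply: sub_path vq => x y /andP[].
Qed.

Lemma orientation_avoiding k s (Phi : pred {ffun T -> 'I_s}) :
  simple_graph e -> 0 < #|T| -> s <= 2 ^ k ->
  (forall phi, Phi phi ->
     4 * #|T| * (k + 3) <= \sum_v #|[pred u | mono e phi u v]|) ->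
  exists F, forall phi, Phi phi -> ~~ acyclic (mono_arc e phi F).
Proof.
move=> sim T0 sk many.
pose B (phi : {ffun T -> 'I_s}) := [set F | acyclic (mono_arc e phi F)].
have [|||F FB] := @union_bound _ _ Phi B (2 ^ (#|T| * k.+1)).
- by apply/card_gt0P; exists set0.
(* There are at most 2^(kn) colourings, each acyclic for a proportion at most 2^(-n(k+1)) of the
   sets F. *)
- apply: leq_ltn_trans (max_card _) _; rewrite card_ffun card_ord.
  apply: leq_ltn_trans (_ : (2 ^ k) ^ #|T| < _).
    by rewrite leq_exp2r.
  by rewrite -expnM ltn_exp2l // mulnC ltn_mul2l T0 ltnSn.
- move=> phi /many H.
  have -> : #|{set T * T}| = 2 ^ (#|T| ^ 2).
    rewrite -[#|T| ^ 2]card_prod -[in RHS]cardsT -card_powerset.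
    by apply: eq_card => X; rewrite !inE subsetT.
  exact: count_acyclic_pow2.
by exists F => phi /FB; rewrite inE.
Qed.

End AvoidingColourings.

(** * Random lists *)

Section Lists.
Variables (k h : nat).
Hypothesis kh : k * k + k <= h.

Definition klist := {A : {set 'I_(2 * h)} | #|A| == k}.

Lemma card_klist : #|{: klist}| = 'C(2 * h, k).
Proof. by rewrite card_sig -(card_ord (2 * h)) -card_draws cardsE card_ord. Qed.

Lemma card_klist_subset (X : {set 'I_(2 * h)}) : h <= #|X| ->
  #|{: klist}| <= 2 ^ k.+1 * #|[pred A : klist | val A \subset X]|.
Proof.
move=> hX; rewrite card_klist; apply: leq_trans (bin_double_leq kh) _.
rewrite leq_mul2l; apply/orP; right.
apply: (@leq_trans 'C(#|X|, k)); first exact: leq_bin2l.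
rewrite -cards_draws -[X in _ <= X](card_imset _ val_inj).
apply: subset_leq_card; apply/subsetP => A; rewrite inE => /andP[AX Ak].
by apply/imsetP; exists (exist _ A Ak); rewrite ?inE.
Qed.
End Lists.

Section RandomLists.
Variables (T : finType) (e : rel T) (k h t : nat).
Hypotheses (sym : symmetric e) (kh : k * k + k <= h) (h0 : 0 < h).
Local Notation colour := 'I_(2 * h).
Local Notation klist := (klist k h).
Implicit Types (B : {set T}) (L : T -> klist) (phi : {ffun T -> colour}).

Definition saturated B L v := [forall X : {set colour}, (#|X| == h) ==>
  (h * t <= #|[set u in B | e v u && (val (L u) \subset X)]|)].

Lemma klist_gt0 : 0 < #|{: klist}|.
Proof. rewrite card_klist bin_gt0; nia. Qed.

(* Lists and a partition into P classes are drawn at random. At most vertices all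
   the classes are saturating, and B is then a smallest class. *)
Lemma saturating_lists P m :
  0 < P -> 4 * (P * 2 ^ (2 * h)) * 2 ^ (h * t) <= 2 ^ m ->
  (forall v, 2 * (P * 2 ^ k.+1) * m <= #|[pred u | e v u]|) ->
  exists B L, P * #|B| <= #|T| /\
    4 * #|[set v | ~~ saturated B L v]| <= #|T|.
Proof.
move=> P0 Pm deg.
pose O : finType := ('I_P * klist)%type.
have cO : #|{: O}| = P * #|{: klist}| by rewrite card_prod card_ord.
have O0 : 0 < #|{: {ffun T -> O}}|.
  by rewrite card_ffun expn_gt0 cO muln_gt0 P0 klist_gt0.
pose S (jX : 'I_P * {set colour}) (u : T) :=
  [pred y : O | (y.1 == jX.1) && (val y.2 \subset jX.2)].
pose Few v jX := [set w : {ffun T -> O} |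
  #|[set u in [set u | e v u] | S jX u (w u)]| < h * t].
pose sized := [pred jX : 'I_P * {set colour} | #|jX.2| == h].
pose U v := \bigcup_(jX | sized jX) Few v jX.
(* Each of the at most P 2^(2h) pairs (class, half) fails at v with probability at most 2^(ht - m),
   so v fails with probability at most 1/4. *)
have U4 v : #|U v| * 4 <= #|{: {ffun T -> O}}|.
  have few jX : sized jX ->
      #|Few v jX| * 2 ^ m <= 2 ^ (h * t) * #|{: {ffun T -> O}}|.
    move=> /= /eqP sX; rewrite card_ffun.
    apply: (@count_few_successes T O [set u | e v u] (S jX) (P * 2 ^ k.+1)).
    - by rewrite muln_gt0 P0 expn_gt0.
    - move=> u _; rewrite cO -mulnA leq_mul2l; apply/orP; right.
      have hX : h <= #|jX.2| by rewrite sX.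
      apply: leq_trans (card_klist_subset kh hX) _.
      rewrite leq_mul2l; apply/orP; right.
      have := cardX (pred1 jX.1) [pred K : klist | val K \subset jX.2].
      rewrite card1 mul1n => <-.
      by apply: subset_leq_card; apply/subsetP => y; rewrite !inE.
    - by rewrite cardsE; apply: deg.
  have := card_bigcup_le few; rewrite -/(U v) => Um.
  have sz : #|sized| <= P * 2 ^ (2 * h).
    apply: leq_trans (max_card _) _; rewrite card_prod card_ord.
    suff -> : #|{set colour}| = 2 ^ (2 * h) by [].
    rewrite -[X in 2 ^ X]card_ord -[in RHS]cardsT -card_powerset.
    by apply: eq_card => X; rewrite !inE subsetT.
  rewrite -(@leq_pmul2r (2 ^ m)) ?expn_gt0 // mulnAC.
  apply: leq_trans (leq_mul Um (leqnn 4)) _.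
  set W := #|{: {ffun T -> O}}|.
  apply: (@leq_trans (4 * (P * 2 ^ (2 * h)) * 2 ^ (h * t) * W)); last first.
    by rewrite [W * _]mulnC; apply: leq_mul.
  rewrite (_ : #|sized| * _ * 4 = 4 * #|sized| * 2 ^ (h * t) * W); last by lia.
  by rewrite !leq_mul.
have [w w4] := averaging O0 U4.
have [||j Pj] := @averaging T 'I_P (fun v => [set (w v).1]) P.
- by rewrite card_ord.
- by move=> v; rewrite cards1 mul1n card_ord.
exists [set v | (w v).1 == j], (fun v => (w v).2); split.
  apply: leq_trans Pj; rewrite leq_mul2l; apply/orP; right.
  by apply: subset_leq_card; apply/subsetP => v; rewrite !inE eq_sym.
apply: leq_trans w4; rewrite leq_mul2l /=.
apply: subset_leq_card; apply/subsetP => v; rewrite !inE.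
rewrite negb_forall => /existsP[X]; rewrite negb_imply -ltnNge => /andP[sX few].
apply/bigcupP; exists (j, X) => //; rewrite inE; apply: leq_ltn_trans few.
apply: subset_leq_card; apply/subsetP => u.
by rewrite !inE /= => /and3P[-> -> ->].
Qed.

Definition saturated_colours B phi v :=
  [set c | t <= #|[set u in B | e v u && (phi u == c)]|].

(** Otherwise some h colours X each occur fewer than t times. The neighbours in B with lists inside
    X are coloured from X, so they number at most h(t - 1), against saturation. *)
Lemma saturated_colours_card B L phi v : saturated B L v ->
  {in B, forall u, phi u \in val (L u)} -> h <= #|saturated_colours B phi v|.
Proof.
move=> sat inL; rewrite leqNgt; apply/negP => lt.
set Y := ~: saturated_colours B phi v.
have hY : h <= #|Y|.
  by have := cardsC (saturated_colours B phi v); rewrite card_ord -/Y; lia.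
have [X] : exists X, X \in [set X : {set colour} | X \subset Y & #|X| == h].
  by apply/card_gt0P; rewrite cards_draws bin_gt0.
rewrite inE => /andP[/subsetP XY /eqP sX].
have few c : c \in X -> #|[set u in B | e v u && (phi u == c)]| < t.
  by move=> /XY; rewrite !inE -ltnNge.
have t0 : 0 < t.
  have /card_gt0P[c /few] : 0 < #|X| by rewrite sX.
  exact: leq_ltn_trans.
have := @card_bigcup_le _ _ (mem X)
  (fun c => [set u in B | e v u && (phi u == c)]) 1 t.-1.
rewrite muln1 sX => /(_ _) H.
have /forallP/(_ X) := sat; rewrite sX eqxx /= leqNgt => /negP; apply.
apply: (@leq_ltn_trans (h * t.-1)); last by rewrite ltn_mul2l h0 ltn_predL.
apply: leq_trans (H _); last by move=> c /few; rewrite muln1; case: t t0.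
apply: subset_leq_card; apply/subsetP => u; rewrite !inE => /and3P[uB vu LX].
apply/bigcupP; exists (phi u); first by apply: (subsetP LX); apply: inL.
by rewrite inE uB vu eqxx.
Qed.

(** With B and its lists fixed, lists outside B are drawn afresh. For one colouring of B, fewer than
    y vertices of A get a list of saturated colours with probability at most 2^(y - m'), and at most
    2^(k|B|) colourings compete. Any such list forces t monochromatic edges at its vertex. *)
Lemma lists_forcing_mono_pairs P m m' y :
  4 <= P -> 4 * (P * 2 ^ (2 * h)) * 2 ^ (h * t) <= 2 ^ m ->
  (forall v, 2 * (P * 2 ^ k.+1) * m <= #|[pred u | e v u]|) ->
  2 * h <= 2 ^ k -> 2 ^ (k + 3) * m' <= #|T| ->
  (forall b, P * b <= #|T| -> k * b + y < m') ->
  exists L, forall phi, (forall v, phi v \in val (L v)) ->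
    y * t <= \sum_v #|[pred u | mono e phi u v]|.
Proof.
move=> P4 Pm deg hk nm' ym'.
have [|B [L1 [PB ns]]] := saturating_lists _ Pm deg; first by lia.
pose A := [set v in ~: B | saturated B L1 v].
have A2 : #|T| <= 2 * #|A|.
  have : #|T| <= #|A| + #|B| + #|[set v | ~~ saturated B L1 v]|.
    set N := [set v | ~~ saturated B L1 v].
    rewrite -cardsT; apply: (@leq_trans #|A :|: B :|: N|); last first.
      apply: leq_trans (leq_card_setU _ _) _; rewrite leq_add2r.
      exact: leq_card_setU.
    apply: subset_leq_card; apply/subsetP => v _; rewrite !inE.
    by case: (v \in B) => //=; case: (saturated _ _ _).
  nia.
(* Colourings of B are encoded as functions equal to the dummy colour [c0] off B, so that they
   number (2h)^|B|. *)
have h2 : 0 < 2 * h by rewrite muln_gt0.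
pose c0 : colour := Ordinal h2.
pose Phi := [pred phi | (phi \in pffun_on c0 (mem B) predT) &&
  [forall u in B, phi u \in val (L1 u)]].
pose Few phi := [set L2 : {ffun T -> klist} |
  #|[set a in A | val (L2 a) \subset saturated_colours B phi a]| < y].
have kB := ym' _ PB.
have [|||L2 L2P] := @union_bound _ _ Phi Few (2 ^ (m' - y)).
- by rewrite card_ffun expn_gt0 klist_gt0.
- apply: (@leq_ltn_trans #|pffun_on c0 (mem B) (@predT colour)|).
    by apply: subset_leq_card; apply/subsetP => phi /andP[].
  rewrite card_pffun_on card_ord.
  apply: (@leq_ltn_trans ((2 ^ k) ^ #|B|)); last first.
    by rewrite -expnM ltn_exp2l //; lia.
  by case: #|B| => // b; rewrite leq_exp2r.
- move=> phi /andP[_ /forall_inP inL].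
  rewrite -(@leq_pmul2r (2 ^ y)) ?expn_gt0 // -mulnA -expnD subnK; last by lia.
  rewrite [X in _ <= X]mulnC card_ffun.
  apply: (@count_few_successes _ _ A
    (fun a => [pred K : klist | val K \subset saturated_colours B phi a])
    (2 ^ k.+1)).
  + by rewrite expn_gt0.
  + move=> a; rewrite !inE => /andP[_ sat]; apply: card_klist_subset => //.
    exact: saturated_colours_card sat inL.
  + by move: nm' A2; rewrite !expnS expnD; lia.
exists (fun v => if v \in B then L1 v else L2 v) => phi phiL.
pose phi' := [ffun v => if v \in B then phi v else c0].
have /L2P : Phi phi'.
  apply/andP; split.
    apply/pffun_onP; split; last by move=> ? _.
    by apply/supportP => v vB; rewrite ffunE (negPf vB).
  by apply/forall_inP => u uB; rewrite ffunE uB; have := phiL u; rewrite uB.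
rewrite inE -leqNgt; set Y := [set a in A | _] => yY.
apply: (@leq_trans (\sum_(v in Y) t)).
  by rewrite sum_nat_const leq_mul2r yY orbT.
rewrite [X in _ <= X](bigID (mem Y)) /=; apply: leq_trans (leq_addr _ _).
apply: leq_sum => a; rewrite !inE => /andP[/andP[aB _] /subsetP sub].
have := sub (phi a); have := phiL a; rewrite (negPf aB) => -> /(_ isT).
rewrite inE => /leq_trans; apply; apply: subset_leq_card; apply/subsetP => u.
rewrite !inE ffunE /mono => /and3P[uB au]; rewrite uB => ->.
by rewrite sym au.
Qed.

End RandomLists.

(** * Choice of the parameters *)

Lemma quadratic_le_exp k : 7 <= k -> 2 * (k * k + k) <= 2 ^ k.
Proof.
elim: k => // k IH; rewrite leq_eqVlt => /predU1P[<- //|].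
by rewrite ltnS => k7; have := IH k7; rewrite expnS; nia.
Qed.

Section LowerBound.
Variables (T : finType) (e : rel T) (k : nat).
Hypotheses (simple : simple_graph e) (T0 : 0 < #|T|) (k7 : 7 <= k).
Hypothesis deg : forall v, k ^ 4 * 2 ^ (3 * k + 19) <= degree e v.
Local Notation h := (k * k + k).
Local Notation t := (2 ^ (k + 9) * (k + 3)).

Lemma lists_forcing_many_mono_pairs :
  exists L : T -> klist k h,
    forall phi : {ffun T -> 'I_(2 * h)}, (forall v, phi v \in val (L v)) ->
      4 * #|T| * (k + 3) <= \sum_v #|[pred u | mono e phi u v]|.
Proof.
(* P gives k|B| <= g, so y = g and m' = 8g satisfy k|B| + y < m'. The summands of m absorb 4P <=
   2^(2k + 8), 2^(2h) and 2^(ht). *)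
pose P := k * 2 ^ (k + 6); pose g := #|T| %/ 2 ^ (k + 6).
pose m := 2 * k + 8 + 2 * h + h * t.
have gT := leq_trunc_div #|T| (2 ^ (k + 6)); rewrite -/g in gT.
have Tg : #|T| < g.+1 * 2 ^ (k + 6) by rewrite ltn_ceil ?expn_gt0.
have g0 : 0 < g.
  rewrite divn_gt0 ?expn_gt0 //; have [v _] := card_gt0P T0.
  apply: leq_trans (leq_trans (deg v) (max_card _)).
  rewrite -[X in X <= _]mul1n leq_mul ?expn_gt0 ?leq_exp2l //; lia.
have k2 : k < 2 ^ k by apply: ltn_expl.
have h0 : 0 < h by lia.
have Pm : 4 * (P * 2 ^ (2 * h)) * 2 ^ (h * t) <= 2 ^ m.
  have P2 : P <= 2 ^ (2 * k + 6).
    rewrite (_ : 2 * k + 6 = k + (k + 6)); last lia.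
    by rewrite [X in _ <= X]expnD leq_mul2r ltnW ?orbT.
  rewrite /m (_ : 2 * k + 8 = 2 + (2 * k + 6)); last lia.
  move: P2; move: (2 * k + 6) (2 * h) (h * t) => a b c P2.
  by rewrite !expnD leq_mul // -mulnA leq_mul // leq_mul.
have deg' v : 2 * (P * 2 ^ k.+1) * m <= #|[pred u | e v u]|.
  apply: leq_trans (deg v); rewrite /m /P.
  have t0 : 4 <= 2 ^ (k + 9).
    by rewrite -[4]/(2 ^ 2) leq_exp2l //; lia.
  (* Here m <= 2ht; afterwards k h (k + 3) <= 2 k^4 uses up the spare factor 2 in 2^(3k + 19). *)
  apply: (@leq_trans (2 * (k * 2 ^ (k + 6) * 2 ^ k.+1) * (2 * (h * t)))).
    rewrite leq_mul2l; apply/orP; right.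
    rewrite [X in _ <= X]mul2n -addnn leq_add2r.
    by move: t0; move: (2 ^ (k + 9)) => a a4; nia.
  rewrite (_ : 2 * (k * 2 ^ (k + 6) * 2 ^ k.+1) * (2 * (h * t))
     = (k * h * (k + 3)) * (2 ^ 2 * 2 ^ (k + 6) * 2 ^ k.+1 * 2 ^ (k + 9)));
     last by lia.
  rewrite -!expnD.
  rewrite (_ : 3 * k + 19 = 1 + (2 + (k + 6) + k.+1 + (k + 9))); last lia.
  rewrite [X in _ <= _ * X]expnD mulnA leq_mul2r; apply/orP; right.
  by rewrite !expnS expn0; nia.
have [|||L LP] := @lists_forcing_mono_pairs T e k h t (proj1 simple) (leqnn _)
  h0 P m (8 * g) g _ Pm deg' (quadratic_le_exp k7) _ _.
- by rewrite /P; have : 0 < 2 ^ (k + 6) by [rewrite expn_gt0]; nia.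
- by rewrite (_ : 2 ^ (k + 3) * (8 * g) = g * 2 ^ (k + 6)) // !expnD; lia.
- move=> b Pb.
  suff : k * b <= g by lia.
  by rewrite leq_divRL ?expn_gt0 //; apply: leq_trans Pb; rewrite /P mulnAC.
exists L => phi /LP; apply: leq_trans.
rewrite mulnA leq_mul2r; apply/orP; right.
(* As g > 0, n < (g + 1) 2^(k+6) <= 2g 2^(k+6). *)
rewrite (_ : g * 2 ^ (k + 9) = 8 * g * 2 ^ (k + 6)); last first.
  by rewrite !expnD; lia.
move: Tg; move: (2 ^ (k + 6)) => a; nia.
Qed.

Lemma not_dichoosable : exists F, ~ dichoosable (orient e F) k.
Proof.
have [L LP] := lists_forcing_many_mono_pairs.
have [F FP] := orientation_avoiding
  (Phi := fun phi => [forall v, phi v \in val (L v)])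
  simple T0 (quadratic_le_exp k7) (fun phi H => LP phi (fun v => forallP H v)).
(* Colours are shifted by one because lists contain positive integers; [psi] below undoes the
   shift. *)
pose colours v := [seq i.+1 | i : 'I_(2 * h) <- enum (val (L v))].
exists F => /(_ (fun v => [fset x in colours v]%fset)) [v|phi [phiL phiA]].
  split; last by move=> i; rewrite in_fset => /mapP[j _ ->].
  rewrite card_fseq undup_id ?map_inj_uniq ?enum_uniq //; last first.
    by move=> i j [/ord_inj].
  by rewrite size_map -cardE (eqP (valP (L v))).
have ex v : exists i, (i \in val (L v)) && (phi v == (i : nat).+1).
  have := phiL v; rewrite in_fset => /mapP[i]; rewrite mem_enum => iL ->.
  by exists i; rewrite iL eqxx.
pose psi := [ffun v => xchoose (ex v)].
have psiP v := xchooseP (ex v).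
have /FP/negP : [forall v, psi v \in val (L v)].
  by apply/forallP=> v; rewrite ffunE; case/andP: (psiP v).
apply; apply: dicoloured_acyclic => c cy cD sub.
apply: (phiA (c : nat).+1 cy cD) => x /sub; rewrite !inE ffunE => /eqP <-.
by case/andP: (psiP x).
Qed.

End LowerBound.

(** * Asymptotics *)

From mathcomp Require Import all_classical all_reals all_analysis.

Import Order.TTheory GRing.Theory Num.Theory.
Local Open Scope ring_scope.

Lemma lt_graph_dichoosability (T : finType) (e : rel T) (k : nat) :
  simple_graph e -> (7 <= k)%N -> (0 < min_degree e)%N ->
  (k ^ 4 * 2 ^ (3 * k + 19) <= min_degree e)%N ->
  (k < graph_dichoosability e)%N.
Proof.
move=> simple k7 d0 kd.
have T0 : (0 < #|T|)%N.
  rewrite lt0n; apply: contraTneq d0 => T0.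
  by rewrite /min_degree big_pred0 ?T0 // => v; have := card0_eq T0 v.
have [_ deg] := min_degreeP (proj2 simple) T0.
have [F nF] := not_dichoosable simple T0 k7 (fun v => leq_trans kd (deg v)).
have oF := orient_orientation simple F.
apply: leq_trans (leq_bigmax_cond _ oF).
rewrite ltnNge; apply/negP => /dichoosabilityP; apply: contra_not nF; apply.
exact: orientation_loopless oF.
Qed.

Lemma exp_le_of_ln (R : realType) (k d : nat) : (0 < k)%N -> (0 < d)%N ->
  4 * ln (k%:R : R) + (3 * k + 19)%:R * ln 2 <= ln d%:R ->
  (k ^ 4 * 2 ^ (3 * k + 19) <= d)%N.
Proof.
move=> k0 d0 H; rewrite -(ler_nat R).
rewrite -ler_ln ?posrE ?ltr0n ?muln_gt0 ?expn_gt0 ?k0 //.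
rewrite natrM !natrX lnM ?posrE ?exprn_gt0 ?ltr0n // !lnXn ?ltr0n //.
by rewrite -[ln _ *+ 4]mulr_natl -[ln 2 *+ _]mulr_natl.
Qed.

Lemma ln_le_sqrt (R : realType) (x : R) : 0 < x -> ln x <= 2 * Num.sqrt x.
Proof.
move=> x0; have s0 : 0 < Num.sqrt x by rewrite sqrtr_gt0.
(* Apply ln y <= y - 1 to y = sqrt x. *)
rewrite -{1}(sqr_sqrtr (ltW x0)) lnXn // -[ln _ *+ 2]mulr_natl ler_pM2l //.
have := @le_ln1Dx R (Num.sqrt x - 1); rewrite addrCA subrr addr0 => H.
by apply: le_trans (H _) _; lra.
Qed.

Theorem theorem1p3 (R : realType) (eps : R) (heps : 0 < eps) :
  exists d0 : nat,
    forall (T : finType) (e : rel T) (d : nat),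
      simple_graph e ->
      min_degree e = d ->
      (d0 <= d)%N ->
      (1 / 3 - eps) * log2 (d%:R : R) <= (graph_dichoosability e)%:R.
Proof.
have ln2 : 0 < ln 2 :> R by rewrite ln_gt0 // ltr1n.
have ln2le : ln 2 <= 1 :> R.
  by have := @le_ln1Dx R 1; rewrite (_ : 1 + 1 = 2) //; apply; lra.
set c := 1 / 3 - eps.
have [c0|c0] := leP c 0.
  exists 1%N => T e d _ _ d1; apply: le_trans (ler0n _ _).
  rewrite mulr_le0_ge0 // /log2 divr_ge0 ?(ltW ln2) // ln_ge0 //.
  by rewrite ler1n.
(* The summands of X ensure x >= 1, sqrt x >= M and c x >= 7 for x = log2 d. *)
pose M := 9 / (eps * ln 2); pose X := 1 + M ^+ 2 + 7 / c.
have M0 : 0 < M by rewrite divr_gt0 // mulr_gt0.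
exists (Num.truncn (expR (X * ln 2))).+1 => T e d simple de d0.
have Xd : expR (X * ln 2) <= d%:R.
  by apply: ltW; apply: lt_le_trans (truncnS_gt _) _; rewrite ler_nat.
have dp : 0 < d%:R :> R by apply: lt_le_trans (expR_gt0 _) Xd.
have lnd : X * ln 2 <= ln d%:R.
  by rewrite -[X in X <= _]expRK ler_ln ?posrE ?expR_gt0.
set x := log2 (d%:R : R).
have xE : ln d%:R = x * ln 2 by rewrite /x /log2 divfK // gt_eqF.
have Xx : X <= x by move: lnd; rewrite xE ler_pM2r.
have c7 : 0 < 7 / c by rewrite divr_gt0.
have M2 : 0 < M ^+ 2 by rewrite exprn_gt0.
have x1 : 1 <= x by move: Xx; rewrite /X; lra.
have cx7 : 7 <= c * x.
  by rewrite mulrC -ler_pdivrMr //; move: Xx; rewrite /X; lra.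
pose k := Num.truncn (c * x).
have cx0 : 0 <= c * x by lra.
have /andP[kcx cxk] := truncn_itv cx0; rewrite -/k in kcx cxk.
have k7 : (7 <= k)%N by rewrite truncn_ge_nat.
apply: le_trans (ltW cxk) _; rewrite ler_nat.
have d_gt0 : (0 < d)%N by rewrite -(ltr0n R).
apply: lt_graph_dichoosability => //; rewrite de //.
have k0 : (0 < k)%N by apply: leq_trans k7.
apply: (@exp_le_of_ln R) => //; rewrite xE.
have s0 : 0 < Num.sqrt x by rewrite sqrtr_gt0; lra.
have lnk : ln k%:R <= 2 * Num.sqrt x.
  have x0 : 0 < x by lra.
  apply: le_trans (@ln_le_sqrt R x x0); rewrite ler_ln ?posrE ?ltr0n //.
  by apply: le_trans kcx _; rewrite ger_pMl /c; lra.
have s1 : 1 <= Num.sqrt x by rewrite -sqrtr1 ler_wsqrtr.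
have Ms : M <= Num.sqrt x.
  rewrite -(ger0_norm (ltW M0)) -sqrtr_sqr ler_wsqrtr //.
  by move: Xx; rewrite /X; lra.
have Ms9 : 9 * Num.sqrt x <= eps * ln 2 * x.
  rewrite -{2}(sqr_sqrtr (_ : 0 <= x)) ?expr2; last lra.
  by rewrite mulrA ler_pM2r // mulrC -ler_pdivrMr ?mulr_gt0.
rewrite natrD natrM.
have : 3 * k%:R * ln 2 <= 3 * (c * x) * ln 2 by rewrite ler_pM2r // ler_pM2l.
(* Since 3c = 1 - 3 eps, the slack is 3 eps x ln 2 >= 27 sqrt x, which covers 4 ln k <= 8 sqrt x and
   19 ln 2 <= 19 sqrt x. *)
rewrite /c; nra.
Qed.
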